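(* Let $f:\mathbb{R}^n\times[0,\infty)\to\mathbb{R}^n$ be continuous and suppose there are diagonal matrices with positive diagonal entries $P=\operatorname{diag}\{p_1,\dots,p_n\}$, $\Delta=\operatorname{diag}\{\Delta_1,\dots,\Delta_n\}$ and a constant $\eta>0$ such that $$(x-y)^{\top}P\big(f(x,t)-\Delta x-f(y,t)+\Delta y\big)\le-\eta\,(x-y)^{\top}(x-y)\qquad\text{for all }x,y\in\mathbb{R}^n,\ t\ge 0.$$ Let $s:[0,\infty)\to\mathbb{R}^n$ be a solution of $\dot s(t)=f(s(t),t)$, let $A=(a_{ij})\in\mathbb{R}^{m\times m}$ satisfy $a_{ij}\ge 0$ for $i\neq j$ and $\sum_{j=1}^m a_{ij}=0$ for all $i$, and let $\varepsilon>0$. Suppose that the directed graph of $A$ has a spanning tree, and let $i_0$ be a node in its root set. Then the network with a single controller at node $i_0$, $$\dot x_{i_0}=f(x_{i_0},t)+c\sum_{j=1}^m a_{i_0j}x_j-c\varepsilon(x_{i_0}-s(t)),\qquad \dot x_i=f(x_i,t)+c\sum_{j=1}^m a_{ij}x_j\quad(i\neq i_0),$$ can be synchronized to $s(t)$: there is $c_0>0$ such that for every coupling strength $c\ge c_0$, every solution on $[0,\infty)$ satisfies $\lim_{t\to\infty}\|x_i(t)-s(t)\|=0$ for all $i=1,\dots,m$. In particular, if the graph is undirected and connected (i.e. $A$ is symmetric and its graph is connected), then the same conclusion holds with the controller placed at any node $i_0\in\{1,\dots,m\}$.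
   Context: The directed graph of $A$ has nodes $1,\dots,m$ and an edge from $j$ to $i$ ($i\ne j$) whenever $a_{ij}>0$. It has a (directed) spanning tree if some node has directed paths to all other nodes; the root set is the set of all nodes having directed paths to all other nodes. Here $x_i(t)\in\mathbb{R}^n$ is the state of node $i$. *)

(* Defs.v *)
From HB Require Import structures.
From mathcomp Require Import all_boot all_order all_algebra.
From mathcomp Require Import all_classical all_reals all_analysis.

Set Implicit Arguments.
Unset Strict Implicit.
Unset Printing Implicit Defensive.
Import Order.TTheory GRing.Theory Num.Theory.
Import numFieldNormedType.Exports.
Local Open Scope classical_set_scope.
Local Open Scope ring_scope.

Section Defs.
Variable R : realType.

(* The canonical norm of ['cV[R]_n] is the sup norm, hence this definition. *)
Definition euclid_norm (n : nat) (v : 'cV[R]_n) : R :=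
  Num.sqrt (\sum_(k < n) v k 0 ^+ 2).

(* Vector fields are total in time, but only the times t >= 0 are constrained. *)
Definition continuous_field (n : nat) (f : 'cV[R]_n -> R -> 'cV[R]_n) : Prop :=
  {within [set z : 'cV[R]_n * R | 0 <= z.2], continuous (fun z => f z.1 z.2)}.

Definition quad_condition (n : nat) (f : 'cV[R]_n -> R -> 'cV[R]_n)
    (P Delta : 'M[R]_n) (eta : R) : Prop :=
  forall (x y : 'cV[R]_n) (t : R), 0 <= t ->
    ((x - y)^T *m P *m (f x t - Delta *m x - f y t + Delta *m y)) 0 0
      <= - eta * ((x - y)^T *m (x - y)) 0 0.

(* Derivative relative to the time domain [0, +oo[: the two-sided derivative
   if t > 0, the right derivative if t = 0. *)
Definition has_deriv_at (n : nat) (x : R -> 'cV[R]_n) (t : R) (v : 'cV[R]_n) :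
    Prop :=
  (u - t)^-1 *: (x u - x t) @[u --> within `[0, +oo[ (t^')] --> v.

Definition ode_solution (n : nat) (f : 'cV[R]_n -> R -> 'cV[R]_n)
    (s : R -> 'cV[R]_n) : Prop :=
  forall t : R, 0 <= t -> has_deriv_at s t (f (s t) t).

Definition coupling_matrix (m : nat) (A : 'M[R]_m) : Prop :=
  (forall i j : 'I_m, i != j -> 0 <= A i j) /\
  (forall i : 'I_m, \sum_(j < m) A i j = 0).

(* [edge A j i] is the edge from j to i, present when node j acts on node i. *)
Definition edge (m : nat) (A : 'M[R]_m) : rel 'I_m :=
  fun j i => (i != j) && (0 < A i j).

Definition in_root_set (m : nat) (A : 'M[R]_m) (i : 'I_m) : Prop :=
  forall j : 'I_m, j != i -> connect (edge A) i j.

Definition has_spanning_tree (m : nat) (A : 'M[R]_m) : Prop :=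
  exists i : 'I_m, in_root_set A i.

Definition graph_connected (m : nat) (A : 'M[R]_m) : Prop :=
  forall i j : 'I_m, connect (edge A) i j.

Definition pinned_solution (n m : nat) (f : 'cV[R]_n -> R -> 'cV[R]_n)
    (s : R -> 'cV[R]_n) (A : 'M[R]_m) (eps c : R) (i0 : 'I_m)
    (x : 'I_m -> R -> 'cV[R]_n) : Prop :=
  forall (i : 'I_m) (t : R), 0 <= t ->
    has_deriv_at (x i) t
      (f (x i t) t + c *: (\sum_(j < m) A i j *: x j t)
       - (if i == i0 then (c * eps) *: (x i t - s t) else 0)).

Definition synchronizable (n m : nat) (f : 'cV[R]_n -> R -> 'cV[R]_n)
    (s : R -> 'cV[R]_n) (A : 'M[R]_m) (eps : R) (i0 : 'I_m) : Prop :=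
  exists c0 : R, 0 < c0 /\
    forall c : R, c0 <= c ->
    forall x : 'I_m -> R -> 'cV[R]_n, pinned_solution f s A eps c i0 x ->
    forall i : 'I_m, euclid_norm (x i t - s t) @[t --> +oo] --> (0 : R).

End Defs.

(* Main.v *)
(* Since [A] has zero row sums, the errors [e_i = x_i - s] are coupled through
   the pinned matrix [M = eps E_(i0,i0) - A]. As every node is reachable from
   [i0], [M] obeys a minimum principle, so it is a nonsingular M-matrix and some
   positive diagonal [xi] makes [xi M + M^T xi] positive definite. For
   [V = sum_i xi_i e_i^T P e_i] the coupling then dissipates at
   least [2 c sum_i b_i e_i^T P e_i], [b_i > 0], which for large [c] absorbs the
   [Delta] terms of the drift; what remains is [V' <= - a V], hence [V] tends to [0]. *)

Require Import Defs.
From HB Require Import structures.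
From mathcomp Require Import all_boot all_order all_algebra.
From mathcomp Require Import all_classical all_reals all_analysis.
From mathcomp Require Import ring lra.

Set Implicit Arguments.
Unset Strict Implicit.
Unset Printing Implicit Defensive.
Import Order.TTheory GRing.Theory Num.Theory.
Import numFieldNormedType.Exports.
Local Open Scope classical_set_scope.
Local Open Scope ring_scope.

(** * M-matrix properties of the pinned coupling matrix *)

Section PinnedMatrix.
Variables (R : realType) (m : nat) (A : 'M[R]_m) (eps : R) (i0 : 'I_m).
Hypothesis A_coupling : coupling_matrix A.
Hypothesis eps_gt0 : 0 < eps.
Hypothesis i0_root : in_root_set A i0.

Definition pinned_mx : 'M[R]_m := eps *: delta_mx i0 i0 - A.

Lemma pinned_mx_offdiag i j : i != j -> pinned_mx i j <= 0.
Proof.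
move=> neq_ij; have := A_coupling.1 _ _ neq_ij; rewrite !mxE.
suff -> : (i == i0) && (j == i0) = false by rewrite mulr0 sub0r oppr_le0.
by apply: contraNF neq_ij => /andP[/eqP-> /eqP->].
Qed.

Lemma pinned_mxE (w : 'I_m -> R) i :
  \sum_j pinned_mx i j * w j =
  eps * (i == i0)%:R * w i0 - \sum_j A i j * w j.
Proof.
under eq_bigr do rewrite !mxE mulrBl.
rewrite big_split /= sumrN; congr (_ - _).
rewrite (bigD1 i0)//= eqxx andbT big1 ?addr0// => j /negPf ->.
by rewrite andbF mulr0 mul0r.
Qed.

(* Minimum principle: the argmin set of [w] is closed under in-neighbours, so a
   negative minimum would be attained at [i0], where [eps] forbids it. *)
Lemma pinned_mx_ge0 (w : 'I_m -> R) :
  (forall i, 0 <= \sum_j pinned_mx i j * w j) -> forall i, 0 <= w i.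
Proof.
move=> Mw_ge0 i1; rewrite leNgt; apply/negP => wi1_lt0.
pose i2 := [arg min_(i < i1) w i]%O.
have w_min j : w i2 <= w j by rewrite /i2; case: arg_minP => // i _ /(_ j); apply.
have wi2_lt0 : w i2 < 0 by exact: le_lt_trans (w_min i1) wi1_lt0.
(* Row [i] of [A] sums to zero, so [w i] can be subtracted from every [w j]; at a minimiser all
   terms are then nonnegative. For [i = i0] this contradicts [Mw_ge0]; otherwise [Mw_ge0] makes
   every term vanish, hence [w j = w i] wherever [A i j > 0]. *)
have argminP i : w i = w i2 -> i != i0 /\ forall j, edge A j i -> w j = w i2.
  move=> wi.
  have Aw j : 0 <= A i j * (w j - w i).
    have [->|ne_ij] := eqVneq i j; first by rewrite subrr mulr0.
    by rewrite mulr_ge0 ?A_coupling.1// wi subr_ge0.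
  have SAw : \sum_j A i j * w j = \sum_j A i j * (w j - w i).
    under [RHS]eq_bigr do rewrite mulrBr.
    by rewrite sumrB -mulr_suml A_coupling.2 mul0r subr0.
  have SAw_ge0 : 0 <= \sum_j A i j * (w j - w i) by exact: sumr_ge0.
  have := Mw_ge0 i; rewrite pinned_mxE SAw.
  have [eq_i|ne_i] := eqVneq i i0.
    have : eps * w i0 < 0 by rewrite -eq_i wi pmulr_rlt0.
    by rewrite mulr1; lra.
  rewrite mulr0 mul0r sub0r oppr_ge0 => SAw_le0; split=> // j /andP[_ Aij].
  have /psumr_eq0P : \sum_j A i j * (w j - w i) = 0 by apply/le_anti/andP.
  move=> /(_ (fun j _ => Aw j) j isT) /eqP.
  by rewrite mulf_eq0 gt_eqF//= subr_eq0 wi => /eqP.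
have [i2_neq _] := argminP i2 erefl.
have /connectP[q] := i0_root i2_neq.
(* The path from [i0] ends at [i2]; minimality is carried backwards along it, edge by edge, to
   [i0]. *)
suff H x : path (edge A) x q -> w (last x q) = w i2 -> w x = w i2.
  move=> /H{}H /(congr1 w)/esym/H w_i0.
  by have [] := argminP _ w_i0; rewrite eqxx.
elim: q x => //= y q IHq x /andP[exy /IHq{}IHq] /IHq wy.
by have [_] := argminP _ wy; apply.
Qed.

(** The minimum principle applies to a kernel vector and to its opposite, so both are nonnegative
    and the vector is zero. *)
Lemma pinned_mx_unit : pinned_mx \in unitmx.
Proof.
rewrite -unitmx_tr -row_free_unit -kermx_eq0; apply/rowV0P => v /sub_kermxP vM.
suff v_ge0 (w : 'rV_m) : w *m pinned_mx^T = 0 -> forall i, 0 <= w 0 i.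
  apply/rowP => i; rewrite mxE; apply: le_anti; rewrite v_ge0// andbT.
  have := v_ge0 (- v) _ i; rewrite mxE oppr_ge0; apply.
  by rewrite mulNmx vM oppr0.
move=> wM; apply: pinned_mx_ge0 => i.
suff -> : \sum_j pinned_mx i j * w 0 j = (w *m pinned_mx^T) 0 i.
  by rewrite wM mxE.
by rewrite mxE; apply: eq_bigr => j _; rewrite [pinned_mx^T _ _]mxE mulrC.
Qed.

(** Minimum principle for a column of the inverse, whose image is a column of the identity. *)
Lemma invmx_pinned_ge0 i j : 0 <= invmx pinned_mx i j.
Proof.
move: i; apply: (@pinned_mx_ge0 (fun i => invmx pinned_mx i j)) => i.
have /matrixP/(_ i j) := mulmxV pinned_mx_unit.
by rewrite !mxE => ->; rewrite ler0n.
Qed.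

(* With [u] and [v] the row and column sums of the inverse of the pinned matrix
   [M], so that [M u = 1] and [M^T v = 1], the weights are [xi = v / u]; writing
   [w = u z] and [2 z_i z_j = z_i^2 + z_j^2 - (z_i - z_j)^2], the last squares
   only help because [M] has nonpositive off-diagonal entries. *)
Lemma pinned_mx_diag_stable : exists xi b : 'I_m -> R,
  [/\ forall i, 0 < xi i, forall i, 0 < b i &
    forall w : 'I_m -> R, \sum_i b i * w i ^+ 2 <=
      \sum_i \sum_j xi i * pinned_mx i j * (w i * w j)].
Proof.
pose N := invmx pinned_mx.
pose u i := \sum_j N i j; pose v j := \sum_i N i j.
have MN := mulmxV pinned_mx_unit; have NM := mulVmx pinned_mx_unit.
have sum_gt0 (F : 'I_m -> R) : (forall i, 0 <= F i) -> ~ (forall i, F i = 0) ->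
    0 < \sum_i F i.
  move=> F_ge0 F_neq0; rewrite lt_def sumr_ge0// andbT; apply/eqP.
  by move=> /psumr_eq0P F0; apply: F_neq0 => i; apply: F0.
(* A nonnegative row with zero sum would vanish, which invertibility forbids; likewise for
   columns. *)
have u_gt0 i : 0 < u i.
  apply: sum_gt0 => [j|N0]; first exact: invmx_pinned_ge0.
  have /matrixP/(_ i i) := NM; rewrite !mxE eqxx big1 => [/esym/eqP|j _].
    by rewrite oner_eq0.
  by rewrite N0 mul0r.
have v_gt0 j : 0 < v j.
  apply: sum_gt0 => [i|N0]; first exact: invmx_pinned_ge0.
  have /matrixP/(_ j j) := MN; rewrite !mxE eqxx big1 => [/esym/eqP|i _].
    by rewrite oner_eq0.
  by rewrite N0 mulr0.
have Mu i : \sum_j pinned_mx i j * u j = 1.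
  under eq_bigr do rewrite mulr_sumr.
  rewrite exchange_big/= (bigD1 i)//= [X in _ + X]big1 => [|k ki].
    by rewrite addr0; have /matrixP/(_ i i) := MN; rewrite !mxE eqxx.
  by have /matrixP/(_ i k) := MN; rewrite !mxE eq_sym (negPf ki).
have vM j : \sum_i v i * pinned_mx i j = 1.
  under eq_bigr do rewrite mulr_suml.
  rewrite exchange_big/= (bigD1 j)//= [X in _ + X]big1 => [|k kj].
    by rewrite addr0; have /matrixP/(_ j j) := NM; rewrite !mxE eqxx.
  by have /matrixP/(_ k j) := NM; rewrite !mxE (negPf kj).
(* By [Mu] and [vM], the symmetrised form has coefficient [(v i + u i) / 2] at [z i ^+ 2]; dividing
   by [u i ^+ 2] returns to [w = u z] and gives [b]. *)
exists (fun i => v i / u i), (fun i => (v i + u i) / (2 * u i ^+ 2)).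
split=> [i|i|w]; first exact: divr_gt0.
  by rewrite divr_gt0 ?addr_gt0// mulr_gt0// exprn_gt0.
pose z i := w i / u i.
have wE i : w i = u i * z i by rewrite /z mulrCA divff ?mulr1// gt_eqF.
have term_ge i j : v i * pinned_mx i j * u j * ((z i ^+ 2 + z j ^+ 2) / 2) <=
    v i / u i * pinned_mx i j * (w i * w j).
  have -> : v i / u i * pinned_mx i j * (w i * w j) =
      v i * pinned_mx i j * u j * (z i * z j).
    by rewrite !wE; field; rewrite gt_eqF.
  have [->|/pinned_mx_offdiag M_le0] := eqVneq i j.
    by rewrite le_eqVlt; apply/orP; left; apply/eqP; field.
  rewrite ler_wnM2l//; last by have := sqr_ge0 (z i - z j); nra.
  by rewrite mulr_le0_ge0 ?mulr_ge0_le0// ltW.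
apply: le_trans (ler_sum _ (fun i _ => ler_sum _ (fun j _ => term_ge i j))).
rewrite le_eqVlt; apply/orP; left; apply/eqP.
transitivity ((\sum_i \sum_j v i * pinned_mx i j * u j * z i ^+ 2 +
  \sum_i \sum_j v i * pinned_mx i j * u j * z j ^+ 2) / 2); last first.
  rewrite -big_split/= mulr_suml; apply: eq_bigr => i _.
  rewrite -big_split/= mulr_suml; apply: eq_bigr => j _.
  by rewrite -mulrDr mulrA.
rewrite [in X in _ + X]exchange_big/= -big_split/= mulr_suml.
apply: eq_bigr => i _; rewrite -!mulr_suml vM.
under [X in X * z i ^+ 2]eq_bigr do rewrite -mulrA.
by rewrite -mulr_sumr Mu wE; field; rewrite gt_eqF.
Qed.

End PinnedMatrix.

(** * Derivatives and exponential decay *)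

(** Near a positive time the restriction to [[0, +oo[] is void, so the limit in [u] becomes the
    usual two-sided one in [h = u - t]. *)
Lemma has_deriv_at_coord (R : realType) (n : nat) (x : R -> 'cV[R]_n) (t : R)
    (v : 'cV[R]_n) (k : 'I_n) : 0 < t -> has_deriv_at x t v ->
  is_derive t 1 (fun u => x u k 0) (v k 0).
Proof.
move=> t_gt0 x_deriv.
have shift_cvg : h *: 1 + t @[h --> (0 : R)] --> t.
  rewrite -[X in _ --> X]add0r -[X in X + t](scale0r (1 : R)).
  by apply: cvgD; [apply: cvgZr_tmp; exact: cvg_id|exact: cvg_cst].
have shift_cvgN : h *: 1 + t @[h --> (0 : R)^'] `=>` within `[0, +oo[ t^'.
  move=> B; rewrite /within/= => tB.
  have tBE : \forall u \near t, u != t -> 0 <= u -> B u.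
    move: tB; apply: filterS => u uB u0.
    by apply: uB; rewrite /= in_itv/= u0.
  have u_ge0 : \forall u \near t, 0 <= u.
    by apply: filterS (lt_nbhsr t_gt0) => u /ltW.
  have hB0 := shift_cvg _ (@filterI _ (nbhs t) _ _ _ tBE u_ge0).
  near=> h.
  have [hB h_ge0] : ((fun u : R => u != t -> 0 <= u -> B u)
      `&` (fun u : R => 0 <= u)) (h *: 1 + t).
    by near: h; apply: nbhs_dnbhs; exact: hB0.
  have h_neq0 : h != 0 by near: h; exact: nbhs_dnbhs_neq.
  by apply: hB => //; rewrite scaler1 -subr_eq0 addrK.
have dq_cvg : h^-1 *: (((fun u => x u k 0) \o shift t) (h *: 1) - x t k 0)
    @[h --> (0 : R)^'] --> v k 0.
  have := cvg_comp _ _ shift_cvgN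
    (cvg_comp _ _ x_deriv (@coord_continuous _ _ _ k 0 v)).
  apply: cvg_trans; apply: near_eq_cvg; near=> h.
  by rewrite /= !mxE scaler1 addrK.
by split; [exact: cvgP dq_cvg|exact: cvg_lim dq_cvg].
Unshelve. all: by end_near. Qed.

Lemma is_derive_sum2_sqr (R : realType) (m n : nat) (q : 'I_m -> 'I_n -> R)
    (e : 'I_m -> 'I_n -> R -> R) (de : 'I_m -> 'I_n -> R) (t : R) :
  (forall i k, is_derive t 1 (e i k) (de i k)) ->
  is_derive t 1 (fun u => \sum_i \sum_k q i k * e i k u ^+ 2)
    (2 * \sum_i \sum_k q i k * (e i k t * de i k)).
Proof.
move=> e_deriv.
have -> : (fun u => \sum_i \sum_k q i k * e i k u ^+ 2) =
    \sum_i \sum_k q i k *: (e i k * e i k).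
  apply/funext => u; rewrite fct_sumE; apply: eq_bigr => i _.
  by rewrite fct_sumE; apply: eq_bigr => k _.
rewrite mulr_sumr; apply: is_derive_sum => i.
rewrite mulr_sumr; apply: is_derive_sum => k.
apply: is_derive_eq; rewrite /GRing.scale/=; ring.
Qed.

(** Gronwall argument with integrating factor [expR (a * t)]: the product [W] is nonincreasing from
    time 1 on, so [V t <= W 1 * expR (- (a * t))]. Starting at 1 stays clear of 0, where no
    derivative is assumed. *)
Lemma is_derive_le_cvg0 (R : realType) (V dV : R -> R) (a : R) : 0 < a ->
  (forall t : R, 0 < t -> 0 <= V t) ->
  (forall t : R, 0 < t -> is_derive t 1 V (dV t)) ->
  (forall t : R, 0 < t -> dV t <= - a * V t) ->
  V t @[t --> +oo] --> 0.
Proof.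
move=> a_gt0 V_ge0 V_deriv dV_le.
pose W := V * (expR \o (fun t => a * t)).
have W_deriv (t : R) : 0 < t -> is_derive t 1 W (expR (a * t) * (dV t + a * V t)).
  move=> t_gt0; have := V_deriv t t_gt0 => ?.
  have ? : is_derive t 1 (fun t => a * t) a.
    apply: is_derive_eq; rewrite /GRing.scale/=; ring.
  apply: is_derive_eq; rewrite /GRing.scale/=; ring.
have W_le (t : R) : 1 <= t -> W t <= W 1.
  move=> t_ge1; apply: (@ler0_derive1_nincry _ W 1) => //.
  - move=> u; rewrite in_itv/= andbT => u_gt1.
    by have [] := W_deriv u (lt_trans ltr01 u_gt1).
  - move=> u; rewrite in_itv/= andbT => u_gt1.
    have u_gt0 := lt_trans ltr01 u_gt1.
    have := W_deriv u u_gt0 => ?; rewrite derive1E derive_val.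
    rewrite mulr_ge0_le0 ?expR_ge0//.
    by have := dV_le u u_gt0; lra.
  - apply: derivable_within_continuous => u; rewrite in_itv/= andbT => u_ge1.
    by have [] := W_deriv u (lt_le_trans ltr01 u_ge1).
have exp_cvg : W 1 * expR (- (a * t)) @[t --> +oo] --> 0.
  rewrite -[X in _ --> X](mulr0 (W 1)); apply: cvgM; first exact: cvg_cst.
  apply: (cvg_comp (fun t => a * t) (fun u => expR (- u)) _ (@cvgr_expR R)).
  exact: gt0_cvgMry.
apply: squeeze_cvgr (cvg_cst 0) exp_cvg.
near=> t; rewrite V_ge0//=.
rewrite expRN ler_pdivlMr ?expR_gt0//.
by apply: W_le.
Unshelve. all: by end_near. Qed.

(** * Lyapunov estimate for the pinned network *)

Lemma quad_condition_coord (R : realType) (n : nat)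
    (f : 'cV[R]_n -> R -> 'cV[R]_n) (p d : 'rV[R]_n) (eta : R)
    (x y : 'cV[R]_n) (t : R) :
  quad_condition f (diag_mx p) (diag_mx d) eta -> 0 <= t ->
  \sum_k p 0 k * ((x k 0 - y k 0) * (f x t k 0 - f y t k 0)) <=
  \sum_k p 0 k * d 0 k * (x k 0 - y k 0) ^+ 2 -
  eta * \sum_k (x k 0 - y k 0) ^+ 2.
Proof.
move=> f_quad t_ge0; have := f_quad x y t t_ge0.
rewrite mul_mx_diag 2!mxE; set F := \sum_k _; set G := \sum_k _.
have -> : F = \sum_k p 0 k * ((x k 0 - y k 0) * (f x t k 0 - f y t k 0)) -
    \sum_k p 0 k * d 0 k * (x k 0 - y k 0) ^+ 2.
  rewrite -sumrB; apply: eq_bigr => k _.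
  by rewrite !mul_diag_mx !mxE; ring.
have -> : G = \sum_k (x k 0 - y k 0) ^+ 2.
  by apply: eq_bigr => k _; rewrite !mxE -expr2.
lra.
Qed.

Lemma root_synchronizable (R : realType) (n m : nat)
    (f : 'cV[R]_n -> R -> 'cV[R]_n) (p d : 'rV[R]_n) (eta : R)
    (s : R -> 'cV[R]_n) (A : 'M[R]_m) (eps : R) (i0 : 'I_m) :
  (forall k, 0 < p 0 k) -> (forall k, 0 < d 0 k) -> 0 < eta ->
  quad_condition f (diag_mx p) (diag_mx d) eta -> ode_solution f s ->
  coupling_matrix A -> 0 < eps -> in_root_set A i0 ->
  synchronizable f s A eps i0.
Proof.
move=> p_gt0 d_gt0 eta_gt0 f_quad s_sol A_coupling eps_gt0 i0_root.
have [xi [b [xi_gt0 b_gt0 stable]]] :=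
  pinned_mx_diag_stable A_coupling eps_gt0 i0_root.
(* The sum dominates each of its nonnegative terms, whence [c0_ge]; the added 1 keeps [c0] positive
   even when [n = 0]. *)
pose c0 := 1 + \sum_i \sum_k xi i * d 0 k / b i.
have c0_term_ge0 i k : 0 <= xi i * d 0 k / b i.
  by rewrite ltW// divr_gt0// mulr_gt0.
have c0_gt0 : 0 < c0.
  by rewrite ltr_pwDl// sumr_ge0// => i _; rewrite sumr_ge0.
have c0_ge i k : xi i * d 0 k <= c0 * b i.
  rewrite -ler_pdivrMr// /c0 (bigD1 i)//= (bigD1 k)//= -!addrA [leRHS]addrCA lerDl.
  rewrite !addr_ge0// ?sumr_ge0// => j _; exact: sumr_ge0.
exists c0; split=> // c c_ge x x_sol.
have c_gt0 : 0 < c by exact: lt_le_trans c_ge.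
pose e i k t := x i t k 0 - s t k 0.
pose rhs i t := f (x i t) t + c *: (\sum_(j < m) A i j *: x j t)
  - (if i == i0 then (c * eps) *: (x i t - s t) else 0).
pose de i k t := rhs i t k 0 - f (s t) t k 0.
have e_deriv i k (t : R) : 0 < t -> is_derive t 1 (e i k) (de i k t).
  move=> t_gt0.
  have ? := has_deriv_at_coord k t_gt0 (x_sol i t (ltW t_gt0)).
  have ? := has_deriv_at_coord k t_gt0 (s_sol t (ltW t_gt0)).
  exact: is_deriveB.
(* Zero row sums cancel the contribution of [s], so the coupling acts on the errors alone. *)
have deE i k t : de i k t = f (x i t) t k 0 - f (s t) t k 0 -
    c * \sum_j pinned_mx A eps i0 i j * e j k t.
  rewrite pinned_mxE /de /rhs !mxE summxE.
  have -> : \sum_j A i j * e j k t = \sum_j (A i j *: x j t) k 0.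
    rewrite /e; under eq_bigr do rewrite mulrBr.
    rewrite sumrB -mulr_suml A_coupling.2 mul0r subr0.
    by apply: eq_bigr => j _; rewrite mxE.
  have [->|_] := eqVneq i i0; rewrite !mxE /e ?mulr1 ?mulr0; ring.
pose V t := \sum_i \sum_k xi i * p 0 k * e i k t ^+ 2.
pose dV t := 2 * \sum_i \sum_k xi i * p 0 k * (e i k t * de i k t).
(* The denominator exceeds every [p 0 k], so the decay [eta] of the unweighted squares also controls
   the [p]-weighted ones. *)
pose a := 2 * eta / (1 + \sum_k p 0 k).
have sp_ge0 : 0 <= \sum_k p 0 k by rewrite sumr_ge0// => k _; exact: ltW.
have a_gt0 : 0 < a by rewrite divr_gt0 ?mulr_gt0 ?ltr_pwDl.
have ap_le k : a * p 0 k <= 2 * eta.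
  rewrite /a mulrAC ler_pdivrMr ?ltr_pwDl// ler_wpM2l ?mulr_ge0 ?ltW//.
  rewrite (bigD1 k)//= addrCA ltrDl ltr_pwDl// sumr_ge0// => j _.
  exact: ltW.
have V_term_ge0 t i k : 0 <= xi i * p 0 k * e i k t ^+ 2.
  by rewrite mulr_ge0 ?sqr_ge0// mulr_ge0// ltW.
have dV_le (t : R) : 0 < t -> dV t <= - a * V t.
  move=> t_gt0.
  have drift : \sum_i xi i * \sum_k p 0 k *
        (e i k t * (f (x i t) t k 0 - f (s t) t k 0)) <=
      \sum_i xi i * (\sum_k p 0 k * d 0 k * e i k t ^+ 2 -
        eta * \sum_k e i k t ^+ 2).
    apply: ler_sum => i _; apply: ler_wpM2l; first exact: ltW.
    exact: (quad_condition_coord (x i t) (s t) f_quad (ltW t_gt0)).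
  (* Diagonal stability, used once for each coordinate [k] on the vector of errors [e i k t]. *)
  have coupling : \sum_k p 0 k * (c * \sum_i b i * e i k t ^+ 2) <=
      \sum_k p 0 k * (c * \sum_i \sum_j
        xi i * pinned_mx A eps i0 i j * (e i k t * e j k t)).
    apply: ler_sum => k _; apply: ler_wpM2l; first exact: ltW.
    by apply: ler_wpM2l; first exact: ltW.
  have dVE : dV t = 2 * (\sum_i xi i * \sum_k p 0 k *
        (e i k t * (f (x i t) t k 0 - f (s t) t k 0)) -
      \sum_k p 0 k * (c * \sum_i \sum_j
        xi i * pinned_mx A eps i0 i j * (e i k t * e j k t))).
    congr (2 * _); under [X in _ - X]eq_bigr do rewrite !mulr_sumr.
    rewrite [X in _ - X]exchange_big/= -sumrB; apply: eq_bigr => i _.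
    rewrite mulr_sumr -sumrB; apply: eq_bigr => k _.
    rewrite deE; set S := \sum_j _; set S' := \sum_j _.
    have -> : S' = xi i * e i k t * S.
      by rewrite /S mulr_sumr; apply: eq_bigr => j _; ring.
    ring.
  suff : \sum_i xi i * (\sum_k p 0 k * d 0 k * e i k t ^+ 2 -
        eta * \sum_k e i k t ^+ 2) -
      \sum_k p 0 k * (c * \sum_i b i * e i k t ^+ 2) <= - (a / 2) * V t.
    by rewrite dVE; lra.
  under [X in _ - X]eq_bigr do rewrite !mulr_sumr.
  rewrite [X in _ - X]exchange_big/= -sumrB mulr_sumr; apply: ler_sum => i _.
  rewrite mulr_sumr -sumrB mulr_sumr -sumrB mulr_sumr; apply: ler_sum => k _.
  have := c0_ge i k; have := ap_le k; have := sqr_ge0 (e i k t).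
  move: (e i k t ^+ 2) => q q_ge0 apk c0k.
  (* The slack in the goal is exactly [h2] plus half of [h1]: [h2] absorbs the [d] term by strong
     coupling, [h1] leaves the decay rate. *)
  have h1 : 0 <= xi i * q * (2 * eta - a * p 0 k).
    by rewrite mulr_ge0 ?mulr_ge0 ?subr_ge0// ltW.
  have h2 : 0 <= p 0 k * q * (c * b i - xi i * d 0 k).
    rewrite mulr_ge0 ?mulr_ge0 ?subr_ge0//; first exact: ltW.
    by rewrite (le_trans c0k)// ler_wpM2r// ltW.
  lra.
have V_cvg : V t @[t --> +oo] --> 0.
  apply: (is_derive_le_cvg0 a_gt0) dV_le => t t_gt0.
    by rewrite sumr_ge0// => i _; rewrite sumr_ge0.
  by apply: is_derive_sum2_sqr => i k; exact: e_deriv.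
move=> i.
(* Each squared error is, up to its positive weight, one nonnegative term of [V], so [V] squeezes
   the squared norm to zero. *)
have e_le k t : e i k t ^+ 2 <= V t / (xi i * p 0 k).
  rewrite ler_pdivlMr ?mulr_gt0// mulrC /V (bigD1 i)//= (bigD1 k)//=.
  by rewrite -addrA lerDl addr_ge0 ?sumr_ge0// => j _; exact: sumr_ge0.
have V_scaled_cvg : V t * \sum_k (xi i * p 0 k)^-1 @[t --> +oo] --> 0.
  rewrite -[X in _ --> X](mul0r (\sum_k (xi i * p 0 k)^-1)).
  exact: cvgMr_tmp.
have sum_cvg : \sum_(k < n) (x i t - s t) k 0 ^+ 2 @[t --> +oo] --> (0 : R).
  apply: squeeze_cvgr (cvg_cst 0) V_scaled_cvg; near=> t.
  rewrite sumr_ge0/= => [|k _]; last exact: sqr_ge0.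
  rewrite mulr_sumr; apply: ler_sum => k _.
  by have := e_le k t; rewrite /e !mxE.
rewrite -[X in _ --> X]sqrtr0.
exact: cvg_comp sum_cvg (@sqrt_continuous R 0).
Unshelve. all: by end_near. Qed.

Theorem proposition2 (R : realType) (n m : nat)
    (f : 'cV[R]_n -> R -> 'cV[R]_n) (p d : 'rV[R]_n) (eta : R)
    (s : R -> 'cV[R]_n) (A : 'M[R]_m) (eps : R)
    (f_cont : continuous_field f)
    (p_gt0 : forall k : 'I_n, 0 < p 0 k)
    (d_gt0 : forall k : 'I_n, 0 < d 0 k)
    (eta_gt0 : 0 < eta)
    (f_quad : quad_condition f (diag_mx p) (diag_mx d) eta)
    (s_sol : ode_solution f s)
    (A_coupling : coupling_matrix A)
    (eps_gt0 : 0 < eps) :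
  (has_spanning_tree A ->
     forall i0 : 'I_m, in_root_set A i0 -> synchronizable f s A eps i0)
  /\
  (A^T = A -> graph_connected A ->
     forall i0 : 'I_m, synchronizable f s A eps i0).
Proof.
have root_sync := root_synchronizable p_gt0 d_gt0 eta_gt0 f_quad s_sol
  A_coupling eps_gt0.
split=> [_ i0|_ A_connected i0]; first exact: root_sync.
(* Connectedness puts every node in the root set. *)
by apply: root_sync => j _; exact: A_connected.
Qed.
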